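(* Let $\alpha,\gamma$ be positive irrational real numbers with $2\alpha+\gamma=1$, and set $\beta=\alpha$. Let $b(n)=\lfloor n/\beta\rfloor$, $c(n)=\lfloor n/\gamma\rfloor$, $B_\alpha=\{\lfloor n/\alpha\rfloor:n\in\mathbb{N}\}$, define $\widetilde{b}(n)=b(n)-1$ for $n\in\mathbb{N}$, $\widetilde{B_\beta}=\{\widetilde{b}(n):n\in\mathbb{N}\}$, and $\widetilde{B_\gamma}=\mathbb{N}\setminus(B_\alpha\cup\widetilde{B_\beta})$, whose $n$th smallest element is denoted $\widetilde{c}(n)$. Then $B_\alpha$, $\widetilde{B_\beta}$, $\widetilde{B_\gamma}$ form a partition of $\mathbb{N}$ satisfying $$\|\widetilde{b}-b\|=1,\qquad \|\widetilde{c}-c\|\le 1.$$ More precisely, $b(n)-\widetilde{b}(n)=1$ and $c(n)-\widetilde{c}(n)\in\{0,1\}$ for all $n\in\mathbb{N}$.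
   Context: $\mathbb{N}=\{1,2,3,\dots\}$. A partition of $\mathbb{N}$ is a collection of subsets such that every positive integer lies in exactly one of them. For sequences $a,b$ indexed by $\mathbb{N}$, $\|a-b\|=\sup\{|a(n)-b(n)|:n\in\mathbb{N}\}$. *)

(* Defs.v *)
From HB Require Import structures.
From mathcomp Require Import all_boot all_order all_algebra.
From mathcomp Require Import all_classical all_reals ereal.

Set Implicit Arguments.
Unset Strict Implicit.
Unset Printing Implicit Defensive.

Import Order.TTheory GRing.Theory Num.Theory.

Local Open Scope classical_set_scope.
Local Open Scope ring_scope.

(* Throughout, a sequence indexed by {1, 2, 3, ...} is a function nat -> int
   of which only the values at positive arguments are ever used.  Its values
   are in int so that subtraction is not truncated. *)
Definition pos_idx : set nat := [set n | (0 < n)%N].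

Definition pos_int : set int := [set m | 0 < m].

Definition seq_range (a : nat -> int) : set int := a @` pos_idx.

Definition beatty (R : realType) (x : R) (n : nat) : int := Num.floor (n%:R / x).

Definition beatty_pred (R : realType) (x : R) (n : nat) : int := beatty x n - 1.

(* The members of a collection are distinguished by their position in s. *)
Definition partition_of_pos (s : seq (set int)) : Prop :=
  (forall i, (i < size s)%N -> nth set0 s i `<=` pos_int) /\
  (forall m, pos_int m -> exists! i, (i < size s)%N /\ nth set0 s i m).

Definition rest_set (R : realType) (alpha beta : R) : set int :=
  pos_int `\` (seq_range (beatty alpha) `|` seq_range (beatty_pred beta)).

Definition is_nth_smallest (S : set int) (n : nat) (m : int) : Prop :=
  S m /\ ([set k | S k /\ k <= m] #= `I_n)%card.

(* The value is 0 when S has no n-th smallest element. *)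
Definition nth_smallest (S : set int) (n : nat) : int :=
  xget 0 [set m | is_nth_smallest S n m].

Definition rest_seq (R : realType) (alpha beta : R) (n : nat) : int :=
  nth_smallest (rest_set alpha beta) n.

(* The supremum is taken in the extended reals, so it is +oo for an unbounded
   difference. *)
Definition sup_dist (R : realType) (a b : nat -> int) : \bar R :=
  ereal_sup [set (`|(a n)%:~R - (b n)%:~R|)%:E | n in pos_idx].

(* Main.v *)
(* Write F(m) for the floor of m alpha.  As alpha is irrational, m lies in
   B_alpha iff F jumps between m and m+1, and in the shifted set iff F jumps
   between m+1 and m+2; as alpha < 1/2 these do not both happen, and the rest
   set has m - F(m+1) - F(m+2) elements up to m.  With 2 alpha + gamma = 1,
   comparing floor(x) + floor(x +- alpha) with floor(2x) shows that this count
   is at least n at m = c(n) and less than n at m = c(n) - 2. *)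
Require Import Defs.
From HB Require Import structures.
From mathcomp Require Import all_boot all_order all_algebra.
From mathcomp Require Import all_classical all_reals ereal.
From mathcomp Require Import zify lra.

Set Implicit Arguments.
Unset Strict Implicit.
Unset Printing Implicit Defensive.

Import Order.TTheory GRing.Theory Num.Theory.

Local Open Scope classical_set_scope.
Local Open Scope ring_scope.

(** * Counting functions and the n-th smallest element *)

Definition count_upto (S : set int) (m : nat) : nat :=
  (\sum_(1 <= k < m.+1) `[< S k%:Z >])%N.

Lemma count_upto0 (S : set int) : count_upto S 0 = 0%N.
Proof. by rewrite /count_upto big_geq. Qed.

Lemma count_uptoS (S : set int) (m : nat) :
  count_upto S m.+1 = (count_upto S m + `[< S m.+1%:Z >])%N.
Proof. by rewrite /count_upto big_nat_recr. Qed.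

Lemma leq_count_upto (S : set int) : {homo count_upto S : m n / (m <= n)%N}.
Proof.
apply: homo_leq => [//|n m p|m]; first exact: leq_trans.
by rewrite count_uptoS leq_addr.
Qed.

Lemma card_count_upto (S : set int) (m : nat) : S `<=` pos_int ->
  ([set k | S k /\ k <= m%:Z] #= `I_(count_upto S m))%card.
Proof.
move=> Spos; elim: m => [|m IHm].
  rewrite count_upto0 II0.
  have -> : [set k | S k /\ k <= 0%:Z] = set0; last exact: card_eq00.
  by apply/seteqP; split=> k //= [/Spos]; rewrite /pos_int /=; lia.
rewrite count_uptoS; case: asboolP => Sm /=; last first.
  rewrite addn0.
  have -> : [set k | S k /\ k <= m.+1%:Z] = [set k | S k /\ k <= m%:Z].
    apply/seteqP; split=> k /= [Sk km]; split=> //; last by lia.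
    have : k <> m.+1%:Z by move=> kE; apply: Sm; rewrite -kE.
    by lia.
  exact: IHm.
rewrite addn1; apply/eq_cardSP; exists m.+1%:Z; first by split.
have -> : [set k | S k /\ k <= m.+1%:Z] `\ m.+1%:Z = [set k | S k /\ k <= m%:Z].
  apply/seteqP; split=> k /=; first by move=> [[Sk km] /= kNm]; split=> //; lia.
  by move=> [Sk km]; split; [split=> //|]; lia.
exact: IHm.
Qed.

(** Trades the cardinality in the definition for a natural number, so that later steps are plain
    arithmetic. *)
Lemma is_nth_smallestP (S : set int) (n m : nat) : S `<=` pos_int ->
  is_nth_smallest S n m%:Z <-> S m%:Z /\ count_upto S m = n.
Proof.
move=> Spos; have cardS := card_count_upto m Spos; split=> -[Sm].
  move=> cardn; split=> //; apply/card_eq_II.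
  by apply: card_eq_trans cardn; rewrite card_eq_sym.
by move=> <-; split.
Qed.

(** The counting function is monotone with steps 0 or 1, so the n-th smallest element is where it
    first reaches [n]: after [M] and no later than [N]. *)
Lemma nth_smallest_bounds (S : set int) (n M N : nat) : S `<=` pos_int ->
    (count_upto S M < n <= count_upto S N)%N ->
  is_nth_smallest S n (nth_smallest S n) /\
  M%:Z < nth_smallest S n <= N%:Z.
Proof.
move=> Spos /andP[ltMn lenN].
have nth_ok : is_nth_smallest S n (nth_smallest S n).
  (* Existence rules out the default value 0; the witness is the least [m] whose count is at least
     [n]. *)
  apply: xgetPex.
  have exn : exists m, (n <= count_upto S m)%N by exists N.
  case: (ex_minnP exn) => -[|m] len minm; first by rewrite count_upto0 in len; lia.
  have ltm : (count_upto S m < n)%N.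
    by rewrite ltnNge; apply/negP => /minm; rewrite ltnn.
  exists m.+1%:Z => /=; apply/(is_nth_smallestP _ _ Spos).
  by move: len; rewrite count_uptoS; case: asboolP => Sm /= len; [split=> //|]; lia.
split=> //; move: nth_ok; set z := nth_smallest S n => nth_ok.
have := Spos _ nth_ok.1; rewrite /pos_int /=.
case: z nth_ok => // -[//|m] /(is_nth_smallestP _ _ Spos)[Sm cntm] _.
apply/andP; split.
  rewrite ltz_nat ltnNge; apply/negP => /(leq_count_upto S).
  by lia.
rewrite lez_nat leqNgt; apply/negP; rewrite ltnS => /(leq_count_upto S).
by move: cntm; rewrite count_uptoS; case: asboolP => //= _; lia.
Qed.

(** * Distance of integer sequences *)

Lemma sup_dist_le (R : realType) (a b : nat -> int) (r : R) :
  (forall n, (0 < n)%N -> `|a n - b n|%:~R <= r) -> (sup_dist R a b <= r%:E)%E.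
Proof.
move=> le_r; apply: ge_ereal_sup => _ [n n0 <-].
by rewrite lee_fin -intrB -intr_norm le_r.
Qed.

Lemma sup_dist_cst (R : realType) (a b : nat -> int) (r : int) :
  (forall n, (0 < n)%N -> `|a n - b n| = r) -> sup_dist R a b = r%:~R%:E.
Proof.
move=> eq_r; rewrite /sup_dist; set A := (X in ereal_sup X).
suff -> : A = [set r%:~R%:E] by rewrite ereal_sup1.
apply/seteqP; split=> [_ [n n0 <-]|_ ->].
  by rewrite /= -intrB -intr_norm eq_r.
by exists 1%N => //; rewrite -intrB -intr_norm eq_r.
Qed.

(** * Floor inequalities *)

Lemma floorD_itv (R : realType) (x a : R) : 0 <= a <= 1 ->
  Num.floor x <= Num.floor (x + a) <= Num.floor x + 1.
Proof.
move=> /andP[a0 a1]; apply/andP; split; first by apply: le_floor; lra.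
rewrite -ltzD1 floor_lt_int !intrD; have := floorD1_gt x; rewrite intrD; lra.
Qed.

(** If the fractional part of [x] is below 1/2, adding [a] does not raise the floor; otherwise it
    raises it by at most 1, and 2x is at least twice the floor of [x] plus 1. *)
Lemma floor_add_le_floor2 (R : realType) (x a : R) : a <= 2^-1 ->
  Num.floor x + Num.floor (x + a) <= Num.floor (2 * x).
Proof.
move=> a2; rewrite floor_ge_int intrD.
have [fx1 fx2] := andP (floor_itv x); rewrite intrD in fx2.
have [xlt|xge] := ltP x ((Num.floor x)%:~R + 2^-1).
  suff : Num.floor (x + a) <= Num.floor x by rewrite -(ler_int R); lra.
  by rewrite -ltzD1 floor_lt_int intrD; lra.
suff : Num.floor (x + a) <= Num.floor x + 1 by rewrite -(ler_int R) intrD; lra.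
by rewrite -ltzD1 floor_lt_int !intrD; lra.
Qed.

Lemma floor2_le_add_floor (R : realType) (x a : R) : a <= 2^-1 ->
  Num.floor (2 * x) - 1 <= Num.floor x + Num.floor (x - a).
Proof.
move=> a2; have [fx1 fx2] := andP (floor_itv x); rewrite intrD in fx2.
have [xlt|xge] := ltP x ((Num.floor x)%:~R + 2^-1).
  have : Num.floor x - 1 <= Num.floor (x - a).
    by rewrite floor_ge_int intrB; lra.
  have : Num.floor (2 * x) < 2 * Num.floor x + 1.
    by rewrite floor_lt_int intrD intrM; lra.
  by lia.
have : Num.floor x <= Num.floor (x - a) by rewrite floor_ge_int; lra.
have : Num.floor (2 * x) < 2 * Num.floor x + 2.
  by rewrite floor_lt_int intrD intrM; lra.
by lia.
Qed.

(** * Membership in a Beatty sequence *)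

Lemma irrational_mul_neq (R : realType) (x : R) (m : nat) (n : int) :
  irrational x -> (0 < m)%N -> m%:R * x != n%:~R.
Proof.
move=> xirr m0; apply/eqP => mx; apply: xirr; exists (n%:~R / m%:R) => //.
rewrite fmorph_div /= ratr_int ratr_nat -mx mulrC mulKf // pnatr_eq0; lia.
Qed.

Lemma beatty_eqP (R : realType) (x : R) (n : nat) (m : int) : 0 < x ->
  beatty x n = m <-> m%:~R * x <= n%:R < (m + 1)%:~R * x.
Proof.
move=> x0; rewrite -ler_pdivlMr // -ltr_pdivrMr // -floor_eq.
by split=> /eqP.
Qed.

(** Both sides say that some integer lies strictly between mx and (m+1)x; irrationality excludes the
    endpoints. *)
Lemma mem_beatty (R : realType) (x : R) (m : nat) :
    0 < x -> irrational x -> (0 < m)%N ->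
  seq_range (beatty x) m%:Z <->
  Num.floor (m%:R * x) < Num.floor (m.+1%:R * x).
Proof.
move=> x0 xirr m0; split.
  move=> [n n0 /(beatty_eqP _ _ x0)].
  rewrite -[m%:Z + 1]/((m + 1)%:Z) addn1 => /andP[lemn ltnm].
  apply: (@lt_le_trans _ _ n%:Z); last by rewrite floor_ge_int ltW.
  by rewrite floor_lt_int lt_neqAle irrational_mul_neq.
set f := Num.floor (m.+1%:R * x) => ltf.
have f0 : 0 < f.
  by apply: le_lt_trans ltf; rewrite floor_ge_int mulr_ge0 // ltW.
(* The integer in the gap is the floor of (m+1)x itself. *)
exists `|f|%N; first by rewrite /pos_idx /=; lia.
apply/(beatty_eqP _ _ x0).
have -> : `|f|%N%:R = f%:~R :> R by rewrite -[in RHS](gtz0_abs f0).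
rewrite -[m%:Z + 1]/((m + 1)%:Z) addn1; apply/andP; split.
  have := floorD1_gt (m%:R * x) => /ltW/le_trans; apply.
  by rewrite ler_int lezD1.
by rewrite lt_neqAle eq_sym irrational_mul_neq //= floor_le.
Qed.

Lemma mem_beatty_pred (R : realType) (x : R) (m : int) :
  seq_range (beatty_pred x) m <-> seq_range (beatty x) (m + 1).
Proof.
by split=> -[n n0 nE]; exists n => //; move: nE; rewrite /beatty_pred; lia.
Qed.

(** * The rest set for a slope below 1/2 *)

Section BeattyRest.
Variables (R : realType) (alpha : R).
Hypotheses (alpha_gt0 : 0 < alpha) (alpha_irr : irrational alpha).
Hypothesis alpha_lt : alpha < 2^-1.

Let F (m : nat) : int := Num.floor (m%:R * alpha).

Let F_step m : F m <= F m.+1 <= F m + 1.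
Proof.
rewrite /F -[m.+1]addn1 natrD mulrDl mul1r.
by apply: floorD_itv; have := alpha_lt; have := alpha_gt0; lra.
Qed.

(** As 2 alpha < 1, two consecutive steps of [F] cannot both be jumps. *)
Let F_step2 m : F m.+2 <= F m + 1.
Proof.
rewrite /F -[m.+2]addn2 natrD mulrDl.
have /andP[] // : F m <= Num.floor (m%:R * alpha + 2 * alpha) <= F m + 1.
by apply: floorD_itv; have := alpha_lt; have := alpha_gt0; lra.
Qed.

(** Keeps the shifted sequence positive. *)
Lemma beatty_ge2 n : (0 < n)%N -> 2 <= beatty alpha n.
Proof.
move=> n0; rewrite /beatty floor_ge_int ler_pdivlMr //.
have : 1 <= n%:R :> R by rewrite ler1n.
by have := alpha_lt; lra.
Qed.

Lemma rest_set_pos : rest_set alpha alpha `<=` pos_int.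
Proof. by move=> m []. Qed.

Lemma mem_rest_set m : (0 < m)%N ->
  rest_set alpha alpha m%:Z <-> F m.+2 = F m.
Proof.
move=> m0; have memA := mem_beatty alpha_gt0 alpha_irr m0.
have memB := mem_beatty alpha_gt0 alpha_irr (isT : 0 < m.+1)%N.
have memP := mem_beatty_pred alpha m%:Z; rewrite -PoszD addn1 in memP.
have := F_step m; have := F_step m.+1; rewrite /F; split.
  move=> [_ /not_orP[/memA + /memP/memB]]; lia.
move=> FE; split; first by rewrite /pos_int /=; lia.
by move=> [/memA|/memP/memB]; lia.
Qed.

(** By induction: passing to m+1, the right side grows by 1 - (F(m+3) - F(m+1)), which is 1 if m+1
    is in the rest set and 0 otherwise. *)
Lemma count_rest_set m :
  (count_upto (rest_set alpha alpha) m)%:Z = m%:Z - F m.+1 - F m.+2.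
Proof.
elim: m => [|m IHm].
  have F1 : F 1 = 0.
    apply/floor_def; rewrite mul1r ltW //=.
    by have := alpha_lt; lra.
  have F2 : F 2 = 0.
    apply/floor_def; rewrite mulr_ge0 ?ltW //=.
    by have := alpha_lt; lra.
  by rewrite count_upto0 F1 F2.
rewrite count_uptoS PoszD IHm.
have := F_step m.+1; have := F_step m.+2; have := F_step2 m.+1.
case: asboolP => /(mem_rest_set (isT : 0 < m.+1)%N); lia.
Qed.

Lemma partition_beatty_rest :
  partition_of_pos [:: seq_range (beatty alpha);
                       seq_range (beatty_pred alpha); rest_set alpha alpha].
Proof.
split=> [[|[|[|//]]] _ m /=|m m0].
- by case=> n /beatty_ge2 + <-; rewrite /pos_int /=; lia.
- by case=> n /beatty_ge2 + <-; rewrite /pos_int /beatty_pred /=; lia.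
- exact: rest_set_pos.
(* A common element would force [F] to jump twice in a row, against [F_step2]. *)
have disjAB : seq_range (beatty alpha) m -> ~ seq_range (beatty_pred alpha) m.
  move: m m0 => [[//|m]|//] _.
  move=> /(mem_beatty alpha_gt0 alpha_irr (isT : 0 < m.+1)%N) + /mem_beatty_pred.
  rewrite -PoszD addn1.
  move=> + /(mem_beatty alpha_gt0 alpha_irr (isT : 0 < m.+2)%N).
  by have := F_step2 m.+1; rewrite /F; lia.
have [Am|nAm] := pselect (seq_range (beatty alpha) m).
  exists 0%N; split=> // -[|[|[|i]]] [i3] //=; first by move/disjAB: Am.
  by case=> _ /not_orP[].
have [Bm|nBm] := pselect (seq_range (beatty_pred alpha) m).
  exists 1%N; split=> // -[|[|[|i]]] [i3] //=.
  by case=> _ /not_orP[].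
exists 2%N; split=> [|[|[|[|i]]] [i3] //=].
by split=> //; split=> // -[].
Qed.

Lemma rest_seq_bounds (gamma : R) (n : nat) :
    2 * alpha + gamma = 1 -> 0 < gamma -> (0 < n)%N ->
  is_nth_smallest (rest_set alpha alpha) n (rest_seq alpha alpha n) /\
  beatty gamma n - 1 <= rest_seq alpha alpha n <= beatty gamma n.
Proof.
move=> sum1 gamma_gt0 n0.
have : 0 < beatty gamma n.
  rewrite /beatty floor_gt0 ler_pdivlMr // mul1r.
  have : 1 <= n%:R :> R by rewrite ler1n.
  by have := alpha_gt0; lra.
case cE: (beatty gamma n) => [c|//] c0.
have /andP[] := (beatty_eqP n c gamma_gt0).1 cE.
rewrite -[c%:Z + 1]/((c + 1)%:Z) addn1 => lecn ltnc.
(* Here 2(c+1) alpha = (c+1) - (c+1) gamma < c+1-n, so F(c+1) + F(c+2) is at most c-n. *)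
have ub : (n <= count_upto (rest_set alpha alpha) c)%N.
  rewrite -lez_nat count_rest_set.
  have := @floor_add_le_floor2 _ (c.+1%:R * alpha) alpha (ltW alpha_lt).
  have -> : c.+1%:R * alpha + alpha = c.+2%:R * alpha.
    by rewrite -[c.+2]addn1 natrD mulrDl mul1r.
  suff : Num.floor (2 * (c.+1%:R * alpha)) < c.+1%:Z - n%:Z by rewrite /F; lia.
  by rewrite floor_lt_int intrB; nra.
(* For c = 1 the truncated [c.-2] is 0, where the count is 0. Otherwise c gamma <= n gives 2c alpha
   >= c-n, hence F(c-1) + F(c) >= c-n-1. *)
have lb : (count_upto (rest_set alpha alpha) c.-2 < n)%N.
  case: c c0 lecn {cE ltnc ub} => [//|[|c]] _ lecn; first by rewrite count_upto0.
  rewrite -ltz_nat count_rest_set.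
  have := @floor2_le_add_floor _ (c.+2%:R * alpha) alpha (ltW alpha_lt).
  have -> : c.+2%:R * alpha - alpha = c.+1%:R * alpha.
    by rewrite -[c.+2]addn1 natrD mulrDl mul1r addrK.
  suff : c.+2%:Z - n%:Z <= Num.floor (2 * (c.+2%:R * alpha)) by rewrite /F /=; lia.
  by rewrite floor_ge_int intrB; nra.
have [|nth_ok /andP[lo hi]] := nth_smallest_bounds rest_set_pos (n := n) (M := c.-2) (N := c).
  by rewrite lb ub.
by split=> //; rewrite /rest_seq; lia.
Qed.

End BeattyRest.

Theorem theorem6 (R : realType) (alpha beta gamma : R)
  (alpha_gt0 : 0 < alpha) (gamma_gt0 : 0 < gamma)
  (alpha_irr : irrational alpha) (gamma_irr : irrational gamma)
  (sum1 : 2 * alpha + gamma = 1) (beta_def : beta = alpha) :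
  (partition_of_pos [:: seq_range (beatty alpha);
                        seq_range (beatty_pred beta);
                        rest_set alpha beta]) /\
  (forall n : nat, (0 < n)%N ->
     is_nth_smallest (rest_set alpha beta) n (rest_seq alpha beta n)) /\
  (sup_dist R (beatty_pred beta) (beatty beta) = 1%:E) /\
  (sup_dist R (rest_seq alpha beta) (beatty gamma) <= 1%:E)%E /\
  (forall n : nat, (0 < n)%N ->
     beatty beta n - beatty_pred beta n = 1 /\
     (beatty gamma n - rest_seq alpha beta n = 0 \/
      beatty gamma n - rest_seq alpha beta n = 1)).
Proof.
subst beta.
(* This is where the positivity of [gamma] bounds the slope. *)
have alpha_lt : alpha < 2^-1 by lra.
have rest_ok n (n0 : (0 < n)%N) :=
  rest_seq_bounds alpha_gt0 alpha_irr alpha_lt sum1 gamma_gt0 n0.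
have beatty_ok n : beatty alpha n - beatty_pred alpha n = 1.
  by rewrite /beatty_pred; lia.
split; first exact: partition_beatty_rest.
split; first by move=> n /rest_ok[].
split; first by apply: (@sup_dist_cst R _ _ 1) => n _; have := beatty_ok n; lia.
split; last by move=> n /rest_ok[_ bounds]; split=> //; lia.
apply: sup_dist_le => n /rest_ok[_ bounds].
by rewrite -[1]/(1%:~R) ler_int; lia.
Qed.
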